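(* Let $s,r\ge 1$ be integers, let $\alpha>0$, let $(a_{ij})_{1\le j<i\le s}$ and $(b_i)_{1\le i\le s}$ be the real coefficients of an explicit $s$-stage Runge-Kutta method, and let $\beta_{ij}$ ($1\le i\le s$, $1\le j\le r$) be real numbers. Then the Modified Singly-RKTASE method with coefficients $(a_{ij},b_i,\beta_{ij},\alpha)$ is a $W$-method with $\hat s=sr$ stages. More precisely, for every $f:\mathbb{R}^d\to\mathbb{R}^d$, every $Y_n\in\mathbb{R}^d$, every $W\in\mathbb{R}^{d\times d}$ and every $h>0$ such that $I-h\alpha W$ is invertible, the approximation $Y_{n+1}$ produced by the Modified Singly-RKTASE method coincides with the approximation $Y_{n+1}$ produced by the singly $W$-method with the same $\alpha$ and the following coefficients: $$L=\begin{pmatrix} L_r & & \\ & \ddots & \\ & & L_r\end{pmatrix}\in\mathbb{R}^{rs\times rs},\qquad \hat A=\begin{pmatrix} 0 & & & \\ A_{21} & 0 & & \\ \vdots & & \ddots & \\ A_{s1} & \cdots & A_{s,s-1} & 0\end{pmatrix}\in\mathbb{R}^{rs\times rs},$$ $$\hat b=(b_1\beta_{11},\ldots,b_1\beta_{1r},\ldots,b_s\beta_{s1},\ldots,b_s\beta_{sr})^T,$$ where $L_r\in\mathbb{R}^{r\times r}$ is the strictly lower triangular matrix all of whose entries below the diagonal are equal to $1$, and for $1\le j<i\le s$, $$A_{ij}=a_{ij}\begin{pmatrix}\beta_{j1} & \cdots & \beta_{jr}\\ \vdots & & \vdots\\ \beta_{j1} & \cdots & \beta_{jr}\end{pmatrix}\in\mathbb{R}^{r\times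 r}.$$
   Context: Both methods are one-step methods for an autonomous system $\frac{d}{dt}Y=f(Y)$ in $\mathbb{R}^d$, with step size $h>0$ and a given matrix $W\in\mathbb{R}^{d\times d}$ (usually some approximation to the Jacobian of $f$ at $Y_n$). Modified Singly-RKTASE (MSRKTASE) method: for $i=1,\ldots,s$ define the operators $T_i=\sum_{j=1}^r\beta_{ij}(I-h\alpha W)^{-j}$. The step from $Y_n$ to $Y_{n+1}$ is given by $$K_i=T_i\, f\Big(Y_n+h\sum_{j=1}^{i-1}a_{ij}K_j\Big),\quad i=1,\ldots,s,\qquad Y_{n+1}=Y_n+h\sum_{i=1}^s b_iK_i .$$ Singly $W$-method with $\hat s$ stages: given a real $\alpha$, a vector $\hat b=(\hat b_i)\in\mathbb{R}^{\hat s}$ and strictly lower triangular matrices $\hat A=(\hat a_{ij})$, $L=(l_{ij})$ in $\mathbb{R}^{\hat s\times\hat s}$, the step from $Y_n$ to $Y_{n+1}$ is given by $$(I-h\alpha W)\widehat K_i=h f\Big(Y_n+\sum_{j=1}^{i-1}\hat a_{ij}\widehat K_j\Big)+h\alpha W\sum_{j=1}^{i-1}l_{ij}\widehat K_j,\quad i=1,\ldots,\hat s,\qquad Y_{n+1}=Y_n+\sum_{i=1}^{\hat s}\hat b_i\widehat K_i .$$ *)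

(* Defs.v *)
From HB Require Import structures.
From mathcomp Require Import all_boot all_order all_algebra reals.
Set Implicit Arguments.
Unset Strict Implicit.
Unset Printing Implicit Defensive.
Import Order.TTheory GRing.Theory Num.Theory.
Local Open Scope ring_scope.

Definition strictly_lower (R : realType) (n : nat) (A : 'M[R]_n) : Prop :=
  forall i j : 'I_n, (i <= j)%N -> A i j = 0.

(* Indices start at 0, so the term beta_{ij} (I - h alpha W)^{-j} with
   j = 1, ..., r carries the exponent [j.+1]. *)
Definition tase_op (R : realType) (d s r : nat) (beta : 'M[R]_(s, r))
    (alpha h : R) (W : 'M[R]_d) (i : 'I_s) : 'M[R]_d :=
  \sum_(j < r) beta i j *: invmx (1%:M - (h * alpha) *: W) ^+ j.+1.

(* Only the entries of [a] strictly below the diagonal are used. *)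
Definition msrktase_step (R : realType) (d s r : nat)
    (a : 'M[R]_s) (b : 'cV[R]_s) (beta : 'M[R]_(s, r)) (alpha : R)
    (f : 'cV[R]_d -> 'cV[R]_d) (W : 'M[R]_d) (h : R)
    (y0 y1 : 'cV[R]_d) : Prop :=
  exists K : 'I_s -> 'cV[R]_d,
    (forall i : 'I_s,
       K i = tase_op beta alpha h W i
               *m f (y0 + h *: \sum_(j < s | (j < i)%N) a i j *: K j)) /\
    y1 = y0 + h *: \sum_(i < s) b i 0 *: K i.

(* The stages are given implicitly, as solutions of linear systems; hence a
   step is a relation between [y0] and [y1]. *)
Definition singly_W_step (R : realType) (d n : nat)
    (A L : 'M[R]_n) (b : 'cV[R]_n) (alpha : R)
    (f : 'cV[R]_d -> 'cV[R]_d) (W : 'M[R]_d) (h : R)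
    (y0 y1 : 'cV[R]_d) : Prop :=
  exists K : 'I_n -> 'cV[R]_d,
    (forall i : 'I_n,
       (1%:M - (h * alpha) *: W) *m K i =
         h *: f (y0 + \sum_(j < n | (j < i)%N) A i j *: K j)
         + (h * alpha) *: W *m (\sum_(j < n | (j < i)%N) L i j *: K j)) /\
    y1 = y0 + \sum_(i < n) b i 0 *: K i.

(* The library's block matrices have dimension [\sum_(i < s) r], which is only
   propositionally equal to [s * r]. *)
Lemma sum_blocks (s r : nat) : (\sum_(i < s) r = s * r)%N.
Proof. by rewrite sum_nat_const card_ord. Qed.

Definition L_block (R : realType) (r : nat) : 'M[R]_r :=
  \matrix_(k < r, l < r) (if (l < k)%N then 1 else 0).

Definition A_block (R : realType) (s r : nat) (a : 'M[R]_s)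
    (beta : 'M[R]_(s, r)) (i j : 'I_s) : 'M[R]_r :=
  a i j *: \matrix_(k < r, l < r) beta j l.

Definition L_hat (R : realType) (s r : nat) : 'M[R]_(s * r) :=
  castmx (sum_blocks s r, sum_blocks s r) (\mxdiag_(i < s) L_block R r).

Definition A_hat (R : realType) (s r : nat) (a : 'M[R]_s)
    (beta : 'M[R]_(s, r)) : 'M[R]_(s * r) :=
  castmx (sum_blocks s r, sum_blocks s r)
    (\mxblock_(i < s, j < s) (if (j < i)%N then A_block a beta i j else 0)).

Definition b_hat (R : realType) (s r : nat) (b : 'cV[R]_s)
    (beta : 'M[R]_(s, r)) : 'cV[R]_(s * r) :=
  castmx (sum_blocks s r, erefl 1%N)
    (\mxcol_(i < s) \col_(j < r) (b i 0 * beta i j)).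

(* Main.v *)
Require Import Defs.
From HB Require Import structures.
From mathcomp Require Import all_boot all_order all_algebra reals.
Set Implicit Arguments.
Unset Strict Implicit.
Unset Printing Implicit Defensive.
Import Order.TTheory GRing.Theory Num.Theory.
Local Open Scope ring_scope.

(** Put [N := (I - h alpha W)^-1] and [g_i := f (Y_n + h sum_j a_ij K_j)].
    Stage [k] (from 0) of block [i] of the W-method is [h N^(k+1) g_i]: since
    [h alpha W N = N - I], the sum [h alpha W (N + ... + N^k)] contributed by
    [L_r] telescopes to [N^k - I], while the weights [beta_ij] in [A_hat] and
    [b_hat] reassemble [h T_i g_i = h K_i]. Both systems of stage equations
    are triangular, hence determine their stages. *)

(** [tagnat] is the indexing behind [\mxblock], [\mxdiag] and [\mxcol], so entries of the cast block
    matrices reduce to these maps. *)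
Definition block_ord (s r : nat) (i : 'I_s) (k : 'I_r) : 'I_(s * r) :=
  cast_ord (sum_blocks s r) (tagnat.Rank i k).

Definition block_row (s r : nat) (p : 'I_(s * r)) : 'I_s :=
  tagnat.sig1 (cast_ord (esym (sum_blocks s r)) p).

Definition block_pos (s r : nat) (p : 'I_(s * r)) : 'I_r :=
  tagnat.sig2 (cast_ord (esym (sum_blocks s r)) p).

Section BlockIndices.
Variables s r : nat.
Implicit Types (i j : 'I_s) (k l : 'I_r) (p : 'I_(s * r)).

Lemma block_rowK i k : block_row (block_ord i k) = i.
Proof. by rewrite /block_row cast_ordK tagnat.Rank1K. Qed.

Lemma block_posK i k : block_pos (block_ord i k) = k.
Proof.
by apply: val_inj; rewrite /block_pos cast_ordK tagnat.Rank2K.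
Qed.

Lemma block_ordK p : block_ord (block_row p) (block_pos p) = p.
Proof. by rewrite /block_ord tagnat.sig2K cast_ordKV. Qed.

Lemma block_ordE i k : block_ord i k = (i * r + k)%N :> nat.
Proof.
rewrite [LHS](@tagnat.RankEsum s (fun=> r) i k) -(big_mkord (fun j : nat => j < i)%N (fun=> r)).
rewrite -(big_nat_widen _ _ _ predT) ?sum_nat_const_nat ?subn0//.
exact: ltnW.
Qed.

(** The order is lexicographic, because offsets inside a block stay below [r]. *)
Lemma ltn_block_ord i j k l :
  (block_ord j l < block_ord i k)%N = (j < i)%N || ((j == i) && (l < k)%N).
Proof.
rewrite !block_ordE -(inj_eq val_inj).
have [lt_ji|lt_ij|/val_inj->] /= := ltngtP j i; last by rewrite ltn_add2l.
- apply: leq_trans (leq_addr k _).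
  by rewrite (leq_trans _ (leq_mul lt_ji (leqnn r)))// mulSn addnC ltn_add2r.
- apply/negbTE; rewrite -leqNgt; apply: leq_trans (leq_addr l _).
  apply: leq_trans (leq_mul lt_ij (leqnn r)).
  by rewrite mulSn addnC leq_add2r ltnW.
Qed.

Lemma big_block_ord (V : nmodType) (P : pred 'I_(s * r))
    (F : 'I_(s * r) -> V) :
  \sum_(p | P p) F p
    = \sum_i \sum_(k | P (block_ord i k)) F (block_ord i k).
Proof.
rewrite pair_big_dep (reindex (fun ik : 'I_s * 'I_r => block_ord ik.1 ik.2))//.
exists (fun p => (block_row p, block_pos p)) => [[i k] _ | p _] /=.
  by rewrite block_rowK block_posK.
by rewrite block_ordK.
Qed.

Variable R : realType.

Lemma A_hat_block (a : 'M[R]_s) (beta : 'M[R]_(s, r)) i j k l :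
  A_hat a beta (block_ord i k) (block_ord j l)
    = if (j < i)%N then a i j * beta j l else 0.
Proof.
rewrite castmxE mxE -!/(block_row _) -!/(block_pos _) !block_rowK !block_posK.
by case: ifP => _; rewrite !mxE.
Qed.

Lemma L_hat_block i j k l :
  L_hat R s r (block_ord i k) (block_ord j l)
    = ((j == i) && (l < k)%N)%:R.
Proof.
rewrite castmxE mxE -!/(block_row _) -!/(block_pos _) !block_rowK !block_posK.
rewrite eq_sym; case: (j == i); last by rewrite mxE.
(* [\mxdiag] inserts its blocks through [conform_mx], which is the identity here since all blocks
   have size [r]. *)
by rewrite conform_mx_id mxE; case: ifP.
Qed.

Lemma b_hat_block (b : 'cV[R]_s) (beta : 'M[R]_(s, r)) i k :
  b_hat b beta (block_ord i k) 0 = b i 0 * beta i k.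
Proof.
by rewrite castmxE mxE -/(block_row _) -/(block_pos _) block_rowK block_posK
  mxE.
Qed.

Lemma strictly_lower_A_hat (a : 'M[R]_s) (beta : 'M[R]_(s, r)) :
  strictly_lower (A_hat a beta).
Proof.
move=> p q; rewrite leqNgt -[p]block_ordK -[q]block_ordK A_hat_block.
by rewrite ltn_block_ord negb_or => /andP[/negbTE->].
Qed.

Lemma strictly_lower_L_hat : strictly_lower (L_hat R s r).
Proof.
move=> p q; rewrite leqNgt -[p]block_ordK -[q]block_ordK L_hat_block.
by rewrite ltn_block_ord negb_or => /andP[_ /negbTE->].
Qed.

End BlockIndices.

Section TriangularSystems.
Variables (T : Type) (n : nat) (F : 'I_n -> ('I_n -> T) -> T).
Hypothesis F_lower : forall (i : 'I_n) K1 K2,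
  (forall j : 'I_n, (j < i)%N -> K1 j = K2 j) -> F i K1 = F i K2.

(** Forward substitution: the equations are solved one index at a time, and [K0] fills the indices
    not yet reached. *)
Lemma triangular_solution (K0 : 'I_n -> T) :
  exists K : 'I_n -> T, forall i, K i = F i K.
Proof.
suff partial m :
    exists K : 'I_n -> T, forall i : 'I_n, (i < m)%N -> K i = F i K.
  by have [K KF] := partial n; exists K => i; apply: KF.
elim: m => [|m [K KF]]; first by exists K0.
(* Only the value at [m] changes; by [F_lower] the equations at indices up to [m] do not see that
   change. *)
exists (fun i : 'I_n => if i == m :> nat then F i K else K i) => i.
rewrite ltnS leq_eqVlt => lt_im.
have eq_lt (j : 'I_n) : (j < m)%N -> (j == m :> nat) = false.
  by move=> /ltn_eqF.
have [eq_im|ne_im] := eqVneq (i : nat) m.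
  by apply: F_lower => j lt_ji; rewrite eq_lt // -eq_im.
move: lt_im; rewrite (negbTE ne_im) /= => lt_im.
rewrite KF //; apply: F_lower => j lt_ji.
by rewrite eq_lt // (ltn_trans lt_ji).
Qed.

Lemma triangular_unique (K1 K2 : 'I_n -> T) :
    (forall i, K1 i = F i K1) -> (forall i, K2 i = F i K2) -> K1 =1 K2.
Proof.
move=> K1F K2F i; have [m] := ubnP (i : nat).
elim: m i => // m IHm i; rewrite ltnS => le_im.
rewrite K1F K2F; apply: F_lower => j lt_ji.
exact: IHm (leq_trans lt_ji le_im).
Qed.

End TriangularSystems.

Section Steps.
Variables (R : realType) (d : nat) (f : 'cV[R]_d -> 'cV[R]_d).
Variables (W : 'M[R]_d) (alpha h : R) (y0 : 'cV[R]_d).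

Lemma lower_sum_eq (n : nat) (i : 'I_n) (c : 'I_n -> R)
    (K1 K2 : 'I_n -> 'cV[R]_d) :
  (forall j : 'I_n, (j < i)%N -> K1 j = K2 j) ->
  \sum_(j < n | (j < i)%N) c j *: K1 j = \sum_(j < n | (j < i)%N) c j *: K2 j.
Proof. by move=> eqK; apply: eq_bigr => j /eqK->. Qed.

Lemma msrktase_step_exists s r (a : 'M[R]_s) b (beta : 'M[R]_(s, r)) :
  exists y1, msrktase_step a b beta alpha f W h y0 y1.
Proof.
have [i K1 K2 eqK|K KE] := triangular_solution (F := fun i K =>
    tase_op beta alpha h W i
      *m f (y0 + h *: \sum_(j < s | (j < i)%N) a i j *: K j)) _ (fun=> 0).
  by rewrite (lower_sum_eq _ eqK).
by exists (y0 + h *: \sum_(i < s) b i 0 *: K i), K.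
Qed.

Lemma msrktase_step_inj s r (a : 'M[R]_s) b (beta : 'M[R]_(s, r)) y1 y2 :
  msrktase_step a b beta alpha f W h y0 y1 ->
  msrktase_step a b beta alpha f W h y0 y2 -> y1 = y2.
Proof.
move=> [K1 [K1E ->]] [K2 [K2E ->]]; congr (_ + _ *: _); apply: eq_bigr => i _.
congr (_ *: _); apply: (triangular_unique (F := fun i K =>
    tase_op beta alpha h W i
      *m f (y0 + h *: \sum_(j < s | (j < i)%N) a i j *: K j)) _ K1E K2E).
by move=> k K K' eqK; rewrite (lower_sum_eq _ eqK).
Qed.

Hypothesis M_unit : 1%:M - (h * alpha) *: W \in unitmx.

Lemma singly_W_step_inj n (A L : 'M[R]_n) b y1 y2 :
  singly_W_step A L b alpha f W h y0 y1 ->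
  singly_W_step A L b alpha f W h y0 y2 -> y1 = y2.
Proof.
(* Multiplying by the inverse of [I - h alpha W] turns the implicit stage equations into the
   explicit form [K i = F i K]. *)
pose F (i : 'I_n) (K : 'I_n -> 'cV[R]_d) :=
  invmx (1%:M - (h * alpha) *: W) *m
    (h *: f (y0 + \sum_(j < n | (j < i)%N) A i j *: K j)
     + (h * alpha) *: W *m (\sum_(j < n | (j < i)%N) L i j *: K j)).
move=> [K1 [K1E ->]] [K2 [K2E ->]]; congr (_ + _); apply: eq_bigr => i _.
congr (_ *: _); apply: (triangular_unique (F := F)) i => i.
- by move=> K K' eqK; rewrite /F !(lower_sum_eq _ eqK).
- by rewrite /F -K1E mulKmx.
- by rewrite /F -K2E mulKmx.
Qed.

(** With [M = I - h alpha W] and [N] its inverse, [h alpha W = I - M] sends [N ^+ l.+1] to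
    [N ^+ l.+1 - N ^+ l]. *)
Lemma resolvent_telescope k :
  (h * alpha) *: W *m
    (\sum_(l < k) invmx (1%:M - (h * alpha) *: W) ^+ l.+1)
  = invmx (1%:M - (h * alpha) *: W) ^+ k - 1%:M.
Proof.
set M := 1%:M - _; set N : 'M[R]_d := invmx M.
have WE : (h * alpha) *: W = 1%:M - M by rewrite /M opprB addrC subrK.
rewrite WE mulmx_sumr.
rewrite (eq_bigr (fun l : 'I_k => N ^+ l.+1 - N ^+ l)) => [|l _]; last first.
  by rewrite mulmxBl mul1mx exprS [N * _]/(N *m _) mulKVmx.
by rewrite -(big_mkord predT (fun l => N ^+ l.+1 - N ^+ l)) telescope_sumr.
Qed.

Lemma msrktase_singly_W_step s r (a : 'M[R]_s) b (beta : 'M[R]_(s, r)) y1 :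
  msrktase_step a b beta alpha f W h y0 y1 ->
  singly_W_step (A_hat a beta) (L_hat R s r) (b_hat b beta) alpha f W h y0 y1.
Proof.
move=> [K [KE ->]]; pose N : 'M[R]_d := invmx (1%:M - (h * alpha) *: W).
pose g (i : 'I_s) := f (y0 + h *: \sum_(j < s | (j < i)%N) a i j *: K j).
pose S (i : 'I_s) (k : nat) := h *: (N ^+ k.+1 *m g i).
pose Khat (p : 'I_(s * r)) := S (block_row p) (block_pos p).
have KhatE i (k : 'I_r) : Khat (block_ord i k) = S i k.
  by rewrite /Khat block_rowK block_posK.
(* Weighting a block of stages by [beta] recovers one Runge-Kutta stage; this serves both the output
   and the arguments of [f]. *)
have sumS i : \sum_(k < r) beta i k *: S i k = h *: K i.
  rewrite KE /tase_op mulmx_suml scaler_sumr; apply: eq_bigr => k _.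
  by rewrite /S -scalemxAl !scalerA mulrC.
exists Khat; split; last first.
  congr (_ + _); rewrite big_block_ord scaler_sumr; apply: eq_bigr => i _.
  rewrite scalerA mulrC -scalerA -sumS scaler_sumr.
  by apply: eq_bigr => k _; rewrite b_hat_block KhatE scalerA.
move=> p; rewrite -[p]block_ordK.
move: (block_row p) (block_pos p) => i k.
(* The value does not depend on [k]: all [r] stages of block [i] evaluate [f] at the same point and
   share [g i]. *)
have sumA : \sum_(q < s * r | (q < block_ord i k)%N)
    A_hat a beta (block_ord i k) q *: Khat q
      = h *: \sum_(j < s | (j < i)%N) a i j *: K j.
  rewrite big_block_ord scaler_sumr [RHS]big_mkcond; apply: eq_bigr => j _.
  under eq_bigr do rewrite A_hat_block KhatE.
  case: ifP => lt_ji; last by rewrite big1 // => l _; rewrite scale0r.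
  rewrite scalerA mulrC -scalerA -sumS scaler_sumr.
  (* For [j < i] the whole block [j] precedes every stage of block [i], so the index condition holds
     for all [l]. *)
  by apply: eq_big => l; rewrite ?ltn_block_ord ?lt_ji // scalerA.
(* Only block [i] contributes, through its stages [l < k]. *)
have sumL : \sum_(q < s * r | (q < block_ord i k)%N)
    L_hat R s r (block_ord i k) q *: Khat q
      = h *: ((\sum_(l < k) N ^+ l.+1) *m g i).
  rewrite big_block_ord (bigD1 i) //= addrC big1 => [|j ne_ji]; last first.
    by apply: big1 => l _; rewrite L_hat_block (negbTE ne_ji) scale0r.
  rewrite add0r mulmx_suml scaler_sumr (big_ord_widen r (S i)) 1?ltnW //.
  apply: eq_big => l; rewrite ltn_block_ord ltnn eqxx //= => lt_lk.
  by rewrite L_hat_block eqxx lt_lk scale1r KhatE.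
(* After telescoping, the right side is [h g_i + h (N^k - I) g_i = h N^k g_i], which is [M] applied
   to [h N^(k+1) g_i]. *)
rewrite sumA sumL -/(g i) KhatE /S -!scalemxAr [in RHS]mulmxA.
rewrite resolvent_telescope [in RHS]mulmxBl mul1mx -scalerDr subrKC.
by rewrite exprS [N * _]/(N *m _) !mulmxA mulmxV // mul1mx.
Qed.

End Steps.

(** Steps being relations, agreement means that both hold of one common [y1] and of no other
    vector. *)
Theorem mainTheorem1 (R : realType) (s r : nat) (hs : (1 <= s)%N)
    (hr : (1 <= r)%N) (alpha : R) (halpha : 0 < alpha)
    (a : 'M[R]_s) (b : 'cV[R]_s) (beta : 'M[R]_(s, r)) :
  strictly_lower (A_hat a beta) /\
  strictly_lower (L_hat R s r) /\
  forall (d : nat) (f : 'cV[R]_d -> 'cV[R]_d) (y0 : 'cV[R]_d)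
      (W : 'M[R]_d) (h : R),
    0 < h -> 1%:M - (h * alpha) *: W \in unitmx ->
    exists y1 : 'cV[R]_d,
      unique (msrktase_step a b beta alpha f W h y0) y1 /\
      unique (singly_W_step (A_hat a beta) (L_hat R s r) (b_hat b beta)
                alpha f W h y0) y1.
Proof.
split; first exact: strictly_lower_A_hat.
split; first exact: strictly_lower_L_hat.
move=> d f y0 W h _ M_unit.
(* Existence is established for the Runge-Kutta step and carried over to the W-method; uniqueness is
   proved separately for each. *)
have [y1 y1P] := msrktase_step_exists f W alpha h y0 a b beta.
have y1W := msrktase_singly_W_step M_unit y1P.
exists y1; split; split=> // y2; first exact: msrktase_step_inj.
exact: singly_W_step_inj.
Qed.
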